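(* Let $m=m_n\ge 1$ and let $f=f_n$ be a probability distribution on $\{0,\dots,n\}$ with $(f)_2\lesssim (f)_0$. Let $G_{nmf}$ be the random intersection graph defined in the context. Then, as $n\to\infty$, \[ \mathbb{P}(G_{nmf} \text{ is connected}) \to \begin{cases} 0 & \text{if } \log n - \frac{m}{n}(f)_1 \to +\infty,\\ 1 & \text{if } \log n - \frac{m}{n}(f)_1 \to -\infty.\end{cases} \]
   Context: $G_{nmf}$ is the random graph on node set $\{1,\dots,n\}$ obtained by sampling mutually independent random sets $V_1,\dots,V_m\subset\{1,\dots,n\}$, each with probability mass function $A\mapsto f(|A|)\binom{n}{|A|}^{-1}$, and declaring an unordered pair $\{i,j\}$ of distinct nodes adjacent iff some $V_k$ contains both $i$ and $j$. Moments: $(f)_r=\sum_{x=2}^n x^r f(x)$. $a_n\lesssim b_n$ means $\limsup a_n/|b_n|<\infty$. *)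

(* Defs.v *)
From HB Require Import structures.
From mathcomp Require Import all_boot all_order all_algebra.
From mathcomp Require Import all_classical all_reals all_analysis.
Set Implicit Arguments. Unset Strict Implicit. Unset Printing Implicit Defensive.
Import Order.TTheory GRing.Theory Num.Theory.
Local Open Scope ring_scope.

Definition is_pmf_on (R : realType) (n : nat) (f : nat -> R) : Prop :=
  (forall x, (x <= n)%N -> 0 <= f x) /\ \sum_(x < n.+1) f x = 1.

Definition fmom (R : realType) (n : nat) (f : nat -> R) (r : nat) : R :=
  \sum_(2 <= x < n.+1) (x%:R) ^+ r * f x.

Definition set_prob (R : realType) (n : nat) (f : nat -> R) (A : {set 'I_n}) : R :=
  f #|A| / ('C(n, #|A|))%:R.

Definition rig_adj (n m : nat) (V : {ffun 'I_m -> {set 'I_n}}) : rel 'I_n :=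
  fun i j => (i != j) && [exists k, (i \in V k) && (j \in V k)].

Definition rig_connected (n m : nat) (V : {ffun 'I_m -> {set 'I_n}}) : bool :=
  [forall i, forall j, connect (rig_adj V) i j].

(* P(G_{nmf} is connected), V_1..V_m independent *)
Definition prob_connected (R : realType) (n m : nat) (f : nat -> R) : R :=
  \sum_(V : {ffun 'I_m -> {set 'I_n}})
     (\prod_(k < m) set_prob f (V k)) * (rig_connected V)%:R.

(* Main.v *)
Require Import Defs.
From HB Require Import structures.
From mathcomp Require Import all_boot all_order all_algebra.
From mathcomp Require Import all_classical all_reals all_analysis.
From mathcomp Require Import zify ring lra.
Set Implicit Arguments. Unset Strict Implicit. Unset Printing Implicit Defensive.
Import Order.TTheory GRing.Theory Num.Theory.
Import numFieldNormedType.Exports.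
Local Open Scope classical_set_scope.
Local Open Scope ring_scope.

(** Write [a := (f)_1 / n], [C] for the moment constant and [L := m a].

If [ln n - L] tends to [+oo], a second-moment argument on the number of isolated
nodes applies: a node is isolated with probability [(1 - a) ^ m], and two nodes
are isolated with probability at most [(1 - 2 a + (f)_2 / (n (n - 1))) ^ m], so
the isolation events are asymptotically uncorrelated while their expected number
is of order [exp (ln n - L)].

If [ln n - L] tends to [-oo], take a union bound over the node sets [S] with
[1 <= |S| <= n / 2] that no [V_k] crosses. With [s = |S|], a single [V_k]
crosses [S] with probability at least [(s / n) (f)_1 max (1 - C s / n, 1 / C)],
which makes the contribution of all [S] of size [s] at most
[exp (1 + C^2 + (ln n - L) / C) ^ s], a geometric sequence with vanishing ratio. *)

(** * Independent random sets *)

Section Expectation.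
Context {R : realType} {n m : nat} {f : nat -> R} (hf : is_pmf_on n f).

Definition expect (X : {ffun 'I_m -> {set 'I_n}} -> R) : R :=
  \sum_(V : {ffun 'I_m -> {set 'I_n}}) (\prod_(k < m) set_prob f (V k)) * X V.

Lemma set_prob_ge0 (A : {set 'I_n}) : 0 <= set_prob f A.
Proof.
rewrite /set_prob divr_ge0 //; apply: hf.1.
by rewrite -[leqRHS]card_ord max_card.
Qed.

Lemma sum_set_prob_card (Q : pred {set 'I_n}) :
  \sum_(A | Q A) set_prob f A =
  \sum_(0 <= x < n.+1) #|[set A | Q A & #|A| == x]%SET|%:R / 'C(n, x)%:R * f x.
Proof.
have hA (A : {set 'I_n}) : (#|A| < n.+1)%N.
  by rewrite ltnS -[leqRHS]card_ord max_card.
rewrite big_mkord (partition_big (fun A => Ordinal (hA A)) xpredT) //=.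
apply: eq_bigr => x _.
rewrite (eq_bigr (fun=> f x / 'C(n, x)%:R)) => [|A /andP[_ /eqP <-]//].
rewrite sumr_const -[LHS]mulr_natl -mulrA (mulrC _^-1); congr (_%:R * _).
by rewrite cardsE; apply: eq_card => A; rewrite unfold_in.
Qed.

(** Since [Q] accepts every set of size at most 1, only sizes [x >= 2] lose mass. This is the range
    of [fmom], so the lost mass can be compared with moments term by term. *)
Lemma sum_set_prob (Q : pred {set 'I_n}) :
  (forall A : {set 'I_n}, (#|A| <= 1)%N -> Q A) ->
  \sum_(A | Q A) set_prob f A = 1 - \sum_(2 <= x < n.+1)
     (1 - #|[set A | Q A & #|A| == x]%SET|%:R / 'C(n, x)%:R) * f x.
Proof.
move=> hQ; rewrite sum_set_prob_card.
have s1 : \sum_(0 <= x < n.+1) f x = 1 by rewrite big_mkord hf.2.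
rewrite -[X in _ = X - _]s1; apply/eqP; rewrite eq_sym subr_eq addrC -subr_eq -sumrB; apply/eqP.
rewrite [RHS](big_nat_widenl 2 0) // [LHS](bigID (leq 2)) /= -[RHS]addr0.
congr (_ + _); first by apply: eq_bigr => x _; rewrite mulrBl mul1r.
rewrite big_nat_cond big1 // => x /andP[/= xn]; rewrite -ltnNge ltnS => x1.
rewrite (_ : [set A | _]%SET = [set A : {set 'I_n} | #|A| == x]%SET); last first.
  apply/setP => A; rewrite !inE; case: eqP => [e|]; last by rewrite andbF.
  by rewrite hQ ?e.
rewrite card_draws card_ord divff ?mul1r ?subrr //.
by rewrite pnatr_eq0 -lt0n bin_gt0 -ltnS.
Qed.

Lemma sum_set_prob1 : \sum_(A : {set 'I_n}) set_prob f A = 1.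
Proof.
rewrite (sum_set_prob (Q := xpredT)) // big_nat big1 ?subr0 // => x /andP[_ xn].
rewrite (_ : [set A | _]%SET = [set A : {set 'I_n} | #|A| == x]%SET); last first.
  by apply/setP => A; rewrite !inE.
rewrite card_draws card_ord divff ?subrr ?mul0r //.
by rewrite pnatr_eq0 -lt0n bin_gt0 -ltnS.
Qed.

(** Independence: by distributivity, the product of [m] equal sums over sets expands into one sum
    over all families [V]. *)
Lemma expect_forall (Q : pred {set 'I_n}) :
  expect (fun V => [forall k, Q (V k)]%:R) = (\sum_(A | Q A) set_prob f A) ^+ m.
Proof.
rewrite -[X in _ ^+ X]card_ord -prodr_const bigA_distr_big /= [RHS]big_mkcond.
apply: eq_bigr => V _; rewrite (_ : V \in _ = [forall k, Q (V k)]).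
  by case: ifP => _; rewrite ?mulr1 ?mulr0.
by apply/ffun_onP/forallP.
Qed.

Lemma ler_expect (X Y : {ffun 'I_m -> {set 'I_n}} -> R) :
  (forall V, X V <= Y V) -> expect X <= expect Y.
Proof.
move=> XY; apply: ler_sum => V _; apply: ler_wpM2l => //.
by apply: prodr_ge0 => k _; exact: set_prob_ge0.
Qed.

Lemma expect_sum (I : finType) (P : pred I)
    (X : I -> {ffun 'I_m -> {set 'I_n}} -> R) :
  expect (fun V => \sum_(i | P i) X i V) = \sum_(i | P i) expect (X i).
Proof. by rewrite exchange_big; apply: eq_bigr => V _; rewrite mulr_sumr. Qed.

Lemma expectZ c (X : {ffun 'I_m -> {set 'I_n}} -> R) :
  expect (fun V => c * X V) = c * expect X.
Proof. by rewrite mulr_sumr; apply: eq_bigr => V _; rewrite mulrCA. Qed.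

Lemma expectD (X Y : {ffun 'I_m -> {set 'I_n}} -> R) :
  expect (fun V => X V + Y V) = expect X + expect Y.
Proof. by rewrite -big_split; apply: eq_bigr => V _; rewrite mulrDr. Qed.

Lemma expect_cst c : expect (fun=> c) = c.
Proof.
rewrite -[RHS]mulr1; have := expect_forall xpredT.
rewrite sum_set_prob1 expr1n => <-; rewrite -expectZ.
apply: eq_bigr => V _; congr (_ * _).
by rewrite (_ : [forall k, _]) ?mulr1 //; apply/forallP.
Qed.

End Expectation.
Arguments expect {R n m} f X.

(** * Binomial ratios and moments *)

(** The ratio is the product of [(k - i) / (n - i)] over [i < x], and each factor is at most
    [k / n]. The induction runs on natural numbers, denominators cleared. *)
Lemma bin_ratio_le {R : realType} (n k x : nat) : (k <= n)%N -> (x <= n)%N ->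
  'C(k, x)%:R / 'C(n, x)%:R <= (k%:R / n%:R : R) ^+ x.
Proof.
move=> kn xn; have C0 : (0 < 'C(n, x))%N by rewrite bin_gt0.
have [n0|n0] := posnP n.
  by move: kn xn; rewrite n0 !leqn0 => /eqP -> /eqP ->; rewrite !bin0 divr1 expr0.
rewrite ler_pdivrMr ?ltr0n // expr_div_n mulrAC ler_pdivlMr ?exprn_gt0 ?ltr0n //.
rewrite -!natrX -!natrM ler_nat {C0}.
elim: x xn => [|x IH] xn; first by rewrite !bin0 !expn0.
rewrite -(leq_pmul2l (ltn0Sn x)) mulnA mul_bin_left mulnCA mul_bin_left.
rewrite !expnSr.
have h : ((k - x) * n <= k * (n - x))%N.
  by rewrite mulnBl mulnBr leq_sub2l // (mulnC k) leq_mul2l kn orbT.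
have := leq_mul h (IH (ltnW xn)).
move: (k - x)%N (n - x)%N 'C(k, x) 'C(n, x) (k ^ x)%N (n ^ x)%N => a b c d u v.
nia.
Qed.

Lemma bin_ratio_pred {R : realType} (n x : nat) : (x <= n)%N -> (0 < n)%N ->
  'C(n.-1, x)%:R / 'C(n, x)%:R = 1 - x%:R / n%:R :> R.
Proof.
move=> xn n0; have C0 : 'C(n, x)%:R != 0 :> R by rewrite pnatr_eq0 -lt0n bin_gt0.
have n0' : n%:R != 0 :> R by rewrite pnatr_eq0 -lt0n.
have := congr1 (fun k => k%:R : R) (mul_bin_down n x).
rewrite !natrM natrB // => h; apply: (mulfI n0'); rewrite mulrA h mulfK //.
by rewrite mulrBr mulr1 mulrCA divff ?mulr1.
Qed.

Section Moments.
Context {R : realType} {n : nat} {f : nat -> R} (hf : is_pmf_on n f).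

Lemma fmom_ge0 r : 0 <= fmom n f r.
Proof.
rewrite /fmom big_nat; apply: sumr_ge0 => x /andP[_ xn].
by rewrite mulr_ge0 ?exprn_ge0 // hf.1.
Qed.

Lemma ler_fmom r s : (r <= s)%N -> fmom n f r <= fmom n f s.
Proof.
move=> rs; rewrite /fmom; apply: ler_sum_nat => x /andP[x2 xn].
apply: ler_wpM2r; first exact: hf.1.
by rewrite ler_weXn2l // ler1n ltnW.
Qed.

Lemma fmom0_le1 : fmom n f 0 <= 1.
Proof.
rewrite /fmom -hf.2 -(big_mkord xpredT) (big_nat_widenl 2 0) //=.
rewrite [leRHS](bigID (leq 2)) /= -[leLHS]addr0; apply: lerD.
  by rewrite le_eqVlt (eq_bigr f) ?eqxx // => x _; rewrite expr0 mul1r.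
rewrite big_nat_cond; apply: sumr_ge0 => x /andP[/andP[_ xn] _].
exact: hf.1.
Qed.

End Moments.

(** * Isolated nodes *)

Section Isolated.
Context {R : realType} {n m : nat} {f : nat -> R} (hf : is_pmf_on n f).

(** The event is that [A] yields no edge at [i]. It fails only if [|A| = x >= 2] and [i] lies in
    [A], which has conditional probability [x / n]. *)
Lemma sum_set_prob_avoid (i : 'I_n) :
  \sum_(A : {set 'I_n} | (#|A| <= 1)%N || (i \notin A)) set_prob f A =
  1 - fmom n f 1 / n%:R.
Proof.
have n0 : (0 < n)%N := leq_ltn_trans (leq0n i) (ltn_ord i).
rewrite (sum_set_prob hf) => [|A ->//].
congr (1 - _); rewrite /fmom mulr_suml; apply: eq_big_nat => x /andP[x2 xn].
rewrite (_ : [set A | _]%SET =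
    [set A : {set 'I_n} | A \subset [set~ i] & #|A| == x]%SET); last first.
  apply/setP => A; rewrite !inE; case: eqP => [e|]; last by rewrite !andbF.
  by rewrite e leqNgt x2 /= finset.subsetC finset.sub1set inE.
rewrite cards_draws cardsC1 card_ord bin_ratio_pred // subKr expr1.
by rewrite mulrAC.
Qed.

(** A uniform [x]-set misses both nodes with probability [(1 - x/n) (1 - x/(n-1))]. In the
    complement, the linear term [x/(n-1)] is lowered to [x/n]. *)
Lemma sum_set_prob_avoid2 (i j : 'I_n) : i != j ->
  \sum_(A : {set 'I_n} | (#|A| <= 1)%N || ((i \notin A) && (j \notin A)))
     set_prob f A
  <= 1 - 2 * (fmom n f 1 / n%:R) + fmom n f 2 / (n%:R * (n%:R - 1)).
Proof.
move=> ij.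
have n1 : (1 < n)%N.
  by have := max_card [set i; j]%SET; rewrite cards2 ij card_ord.
have n1' : (1 : R) < n%:R by rewrite ltr1n.
rewrite (sum_set_prob hf) => [|A ->//].
rewrite -lerBlDr -addrA -opprD lerD2l lerN2 -lerBlDr /fmom.
rewrite !(mulr_suml, mulr_sumr) -sumrB; apply: ler_sum_nat => x /andP[x2 xn].
rewrite (_ : [set A | _]%SET =
    [set A : {set 'I_n} | A \subset ~: [set i; j] & #|A| == x]%SET); last first.
  apply/setP => A; rewrite !inE; case: eqP => [e|]; last by rewrite !andbF.
  by rewrite e leqNgt x2 /= finset.subsetC finset.subUset !finset.sub1set !inE.
rewrite cards_draws cardsCs finset.setCK cards2 card_ord ij subn2.
have -> : 'C(n.-2, x)%:R / 'C(n, x)%:R =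
          (1 - x%:R / n%:R) * (1 - x%:R / (n%:R - 1)) :> R.
  rewrite (_ : n%:R - 1 = n.-1%:R :> R); last by rewrite -subn1 natrB // ltnW.
  (* The factorisation through ['C(n.-1, x)] divides by it, and it vanishes exactly when [x = n]. *)
  have [exn|xn'] := eqVneq x n.
    by rewrite exn bin_small ?mul0r ?divff ?subrr ?mul0r // ?pnatr_eq0; lia.
  rewrite -bin_ratio_pred ?(ltnW n1) // -bin_ratio_pred; try lia.
  rewrite [RHS]mulrC mulrA divfK // pnatr_eq0 -lt0n bin_gt0; lia.
have f0 : 0 <= f x by exact: hf.1.
set u : R := x%:R; set N : R := n%:R.
have -> : 2 * (u ^+ 1 * f x / N) - u ^+ 2 * f x / (N * (N - 1)) =
          (2 * (u / N) - u ^+ 2 / (N * (N - 1))) * f x by ring.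
apply: ler_wpM2r => //.
have N1 : 1 < N := n1'.
have -> : 1 - (1 - u / N) * (1 - u / (N - 1)) =
          u / N + u / (N - 1) - u ^+ 2 / (N * (N - 1)).
  by field; apply/andP; split; lra.
rewrite lerD2r mulr_natl mulr2n lerD2l ler_wpM2l ?ler0n // lef_pV2 ?posrE; lra.
Qed.

(** The singleton of [i] creates no edge, hence the alternative on sizes. The condition bears on
    each [V k] separately, as [expect_forall] requires. *)
Definition isolated (i : 'I_n) (V : {ffun 'I_m -> {set 'I_n}}) : bool :=
  [forall k, (#|V k| <= 1)%N || (i \notin V k)].

Lemma isolated_not_connected (i : 'I_n) (V : {ffun 'I_m -> {set 'I_n}}) :
  (1 < n)%N -> isolated i V -> ~~ rig_connected V.
Proof.
move=> n1 /forallP iso.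
have [j ji] : exists j : 'I_n, j != i.
  have /card_gt0P[j] : (0 < #|[set~ i]%SET|)%N by rewrite cardsC1 card_ord; lia.
  by rewrite !inE => ji; exists j.
apply/negP => /forallP/(_ i)/forallP/(_ j)/connectP[[|v p]] /= .
  by move=> _ e; rewrite e eqxx in ji.
move=> /andP[/andP[iv /existsP[k /andP[ik vk]]] _] _.
have := iso k; rewrite ik orbF => /card_le1_eqP/(_ _ _ ik vk) e.
by rewrite e eqxx in iv.
Qed.

Lemma expect_isolated (i : 'I_n) :
  expect f (fun V => (isolated i V)%:R) = (1 - fmom n f 1 / n%:R) ^+ m.
Proof. by rewrite -(sum_set_prob_avoid i) -expect_forall. Qed.

Lemma expect_isolated2 (i j : 'I_n) : i != j ->
  expect f (fun V => (isolated i V && isolated j V)%:R) <=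
  (1 - 2 * (fmom n f 1 / n%:R) + fmom n f 2 / (n%:R * (n%:R - 1))) ^+ m.
Proof.
move=> ij; apply: le_trans (lerXn2r _ _ _ (sum_set_prob_avoid2 ij)); last 2 first.
- by apply: sumr_ge0 => A _; exact: set_prob_ge0.
- apply: le_trans (sum_set_prob_avoid2 ij).
  by apply: sumr_ge0 => A _; exact: set_prob_ge0.
rewrite -expect_forall; apply: ler_expect => // V; rewrite ler_nat.
case: andP => // -[/forallP Vi /forallP Vj]; rewrite lt0b; apply/forallP => k.
by have := Vi k; have := Vj k; case: (#|V k| <= 1)%N => //= -> ->.
Qed.

End Isolated.

(** Chebyshev: with [N] the number of events that occur and [mu = n p] its mean, the indicator of
    [N = 0] is at most [(N / mu - 1) ^ 2]. *)
Lemma second_moment {R : realType} {n m : nat} {f : nat -> R}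
    (I : 'I_n -> {ffun 'I_m -> {set 'I_n}} -> bool) (p q : R) :
  is_pmf_on n f -> (0 < n)%N -> 0 < p -> 0 <= q ->
  (forall i, expect f (fun V => (I i V)%:R) = p) ->
  (forall i j, i != j -> expect f (fun V => (I i V && I j V)%:R) <= q) ->
  expect f (fun V => [forall i, ~~ I i V]%:R) <= (n%:R * p)^-1 + q / p ^+ 2 - 1.
Proof.
move=> hf n0 p0 q0 hp hq; set mu := n%:R * p.
have n0' : 0 < n%:R :> R by rewrite ltr0n.
have mu0 : 0 < mu by rewrite mulr_gt0.
pose N V : R := \sum_i (I i V)%:R.
have EN : expect f N = mu.
  by rewrite expect_sum (eq_bigr (fun=> p)) // sumr_const card_ord -mulr_natl.
have EN2 : expect f (fun V => N V ^+ 2) <= mu + n%:R ^+ 2 * q.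
  have -> : expect f (fun V => N V ^+ 2) =
      expect f (fun V => \sum_i \sum_j (I i V && I j V)%:R).
    apply: eq_bigr => V _; congr (_ * _); rewrite expr2 mulr_suml.
    apply: eq_bigr => i _; rewrite mulr_sumr.
    by apply: eq_bigr => j _; rewrite -natrM mulnb.
  rewrite expect_sum.
  have -> : mu + n%:R ^+ 2 * q = \sum_(i < n) (p + n%:R * q).
    by rewrite sumr_const card_ord -mulr_natl /mu; ring.
  apply: ler_sum => i _; rewrite expect_sum (bigD1 i) //=; apply: lerD.
    by rewrite -(hp i) le_eqVlt; apply/orP; left; apply/eqP;
      apply: eq_bigr => V _; rewrite andbb.
  have -> : n%:R * q = \sum_(j < n) q by rewrite sumr_const card_ord mulr_natl.
  (* The diagonal pair, already counted by [p], is granted a further [q >= 0], which gives [n ^ 2 q]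
     instead of [n (n - 1) q]. *)
  rewrite [leRHS](bigD1 i) //= -[leLHS]add0r; apply: lerD => //.
  by apply: ler_sum => j ji; apply: hq; rewrite eq_sym.
apply: (@le_trans _ _ (expect f (fun V => mu ^- 2 * N V ^+ 2 + (- 2 / mu * N V + 1)))).
  apply: ler_expect => // V.
  have -> : mu ^- 2 * N V ^+ 2 + (- 2 / mu * N V + 1) = (N V / mu - 1) ^+ 2.
    by field; rewrite gt_eqF.
  case: forallP => [h|_]; last exact: sqr_ge0.
  have -> : N V = 0 by rewrite /N big1 // => i _; rewrite (negbTE (h i)).
  by rewrite mul0r sub0r sqrrN expr1n.
rewrite !expectD !expectZ expect_cst // EN.
have -> : - 2 / mu * mu + 1 = -1 by rewrite divfK ?gt_eqF //; ring.
rewrite lerD2r ler_pdivrMl ?exprn_gt0 //; apply: le_trans EN2 _.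
rewrite le_eqVlt; apply/orP; left; apply/eqP.
by rewrite /mu; field; rewrite !gt_eqF.
Qed.

Lemma prob_connected_le {R : realType} (n m : nat) (f : nat -> R) :
  is_pmf_on n f -> (1 < n)%N -> fmom n f 1 / n%:R < 1 ->
  prob_connected n m f <=
    (n%:R * (1 - fmom n f 1 / n%:R) ^+ m)^-1 +
    (1 - 2 * (fmom n f 1 / n%:R) + fmom n f 2 / (n%:R * (n%:R - 1))) ^+ m /
      ((1 - fmom n f 1 / n%:R) ^+ m) ^+ 2 - 1.
Proof.
move=> hf n1 a1.
apply: (@le_trans _ _ (expect f (fun V : {ffun 'I_m -> {set 'I_n}} =>
    [forall i, ~~ isolated i V]%:R))).
  apply: ler_expect => // V; rewrite ler_nat; case: (boolP (rig_connected V)) => // cV.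
  rewrite lt0b; apply/forallP => i; apply/negP => iV.
  by move: cV; apply/negP; exact: isolated_not_connected iV.
apply: second_moment => //.
- exact: ltnW.
- by rewrite exprn_gt0 // subr_gt0.
(* The bound [q] is nonnegative because it dominates a probability for the two distinct nodes 0 and
   1. *)
- apply: le_trans (expect_isolated2 hf (_ : Ordinal (ltnW n1) != Ordinal n1)) => //.
  by rewrite -(expect_cst (m := m) hf 0); apply: ler_expect => // V.
- by move=> i; exact: expect_isolated.
- by move=> i j ij; exact: expect_isolated2.
Qed.

(** The first exponential bounds the inverse of the mean number of isolated nodes. The second bounds
    the correlation ratio by [exp (4 m b)], where [m b <= 8 C / ln n]. *)
Lemma prob_connected_le_expR {R : realType} (n m : nat) (f : nat -> R) (C : R) :
  is_pmf_on n f -> (1 < n)%N -> 1 <= C -> 2 * C <= n%:R ->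
  fmom n f 2 <= C * fmom n f 0 -> m%:R / n%:R * fmom n f 1 <= ln n%:R ->
  prob_connected n m f <=
    expR (2 * C - (ln n%:R - m%:R / n%:R * fmom n f 1)) +
    expR (32 * C / ln n%:R) - 1.
Proof.
move=> hf n1 C1 Cn hC hL.
set L := m%:R / n%:R * _ in hL *; set u := ln n%:R in hL *.
have N1 : 1 < n%:R :> R by rewrite ltr1n.
have N2 : 2 <= n%:R :> R by rewrite ler_nat.
have u0 : 0 < u by rewrite ln_gt0.
have N0 : 0 < n%:R :> R by lra.
have nE : n%:R = expR u by rewrite lnK ?posrE.
have f10 := fmom_ge0 hf 1; have f20 := fmom_ge0 hf 2.
have f01 := ler_fmom hf (leq0n 1); have f12 := ler_fmom hf (leqnSn 1).
have f1C : fmom n f 1 <= C.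
  apply: (le_trans (le_trans f12 hC)); rewrite -[leRHS]mulr1 ler_wpM2l ?fmom0_le1 //.
  lra.
set a := fmom n f 1 / n%:R; set b := fmom n f 2 / (n%:R * (n%:R - 1)).
have a0 : 0 <= a by rewrite divr_ge0 // ltW.
have aC : a * n%:R <= C by rewrite /a divfK // gt_eqF.
have a2 : a <= 2^-1 by rewrite ler_pdivrMr //; lra.
have b0 : 0 <= b by rewrite divr_ge0 // mulr_ge0 //; lra.
have La : L = m%:R * a by rewrite /L /a; ring.
have L0 : 0 <= L by rewrite La mulr_ge0.
apply: (le_trans (prob_connected_le _ hf n1 _)); first by rewrite -/a; lra.
rewrite -/a -/b lerD2r; apply: lerD.
  (* Here [(1 + a + 2 a^2) (1 - a) = 1 + a^2 (1 - 2 a) >= 1], as [a <= 1/2]. *)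
  have h : expR (- (a + 2 * a ^+ 2)) <= 1 - a.
    rewrite expRN invf_ple ?posrE ?expR_gt0 //; last by lra.
    apply: le_trans (expR_ge1Dx _); rewrite -[leLHS]mul1r ler_pdivrMr; last by lra.
    have : 0 <= a ^+ 2 * (1 - 2 * a) by rewrite mulr_ge0 ?sqr_ge0 //; lra.
    by lra.
  have h2 : expR (- (L + 2 * (L * a))) <= (1 - a) ^+ m.
    have -> : - (L + 2 * (L * a)) = m%:R * - (a + 2 * a ^+ 2) by rewrite La; ring.
    by rewrite expRM_natl; apply: lerXn2r; rewrite ?nnegrE ?expR_ge0 //; lra.
  (* [L <= ln n <= n] and [a n <= C]. *)
  have LaC : L * a <= C.
    apply: le_trans aC; rewrite mulrC ler_wpM2l //; apply: le_trans hL _.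
    exact/ltW/ln_sublinear.
  rewrite invf_ple ?posrE ?expR_gt0 //; last first.
    by rewrite mulr_gt0 // exprn_gt0 //; lra.
  rewrite -expRN; apply: (@le_trans _ _ (n%:R * expR (- (L + 2 * (L * a))))).
    by rewrite nE -expRD ler_expR; lra.
  by rewrite ler_pM2l.
(* The left side is at most [(1 - a)^2 + b], and [(1 - a)^2 >= 1/4] lets [b] be absorbed as
   [(1 - a)^2 * 4 b]. *)
have ab : 1 - 2 * a + b <= (1 - a) ^+ 2 * expR (4 * b).
  have q4 : 4^-1 <= (1 - a) ^+ 2 by nra.
  apply: (@le_trans _ _ ((1 - a) ^+ 2 * (1 + 4 * b))); last first.
    by rewrite ler_wpM2l ?sqr_ge0 ?expR_ge1Dx.
  by have := sqr_ge0 a; nra.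
rewrite exprAC ler_pdivrMr ?exprn_gt0 //; try lra.
apply: (@le_trans _ _ (((1 - a) ^+ 2 * expR (4 * b)) ^+ m)).
  apply: lerXn2r; rewrite ?nnegrE //; first by lra.
  by rewrite mulr_ge0 ?sqr_ge0 ?expR_ge0.
rewrite exprMn mulrC; apply: ler_wpM2r; first by rewrite exprn_ge0 ?sqr_ge0.
rewrite -expRM_natl ler_expR.
have mb : m%:R * b <= C * u / (n%:R - 1).
  have -> : m%:R * b = m%:R / n%:R * fmom n f 2 / (n%:R - 1).
    by rewrite /b invfM; ring.
  rewrite ler_wpM2r ?invr_ge0 //; first by lra.
  apply: (@le_trans _ _ (C * L)); last by rewrite ler_wpM2l //; lra.
  rewrite /L mulrCA; apply: ler_wpM2l; first by rewrite divr_ge0.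
  by apply: le_trans hC _; rewrite ler_wpM2l //; lra.
(* From [u / 2 <= exp (u / 2)], whose square is [n]. Then [4 n <= 8 (n - 1)] gives the constant 8
   below. *)
have un : u ^+ 2 <= 4 * n%:R.
  have h : 0 <= u / 2 <= expR (u / 2).
    by rewrite divr_ge0 ?ltW //=; apply: lt_le_trans (expR_ge1Dx _); rewrite ltrDr.
  have -> : n%:R = expR (u / 2) ^+ 2 :> R.
    by rewrite -expRM_natl mulrCA divff // mulr1.
  by case/andP: h => h1 h2; nra.
have h8 : u / (n%:R - 1) <= 8 / u.
  by rewrite ler_pdivrMr ?ler_pdivlMr; [|lra..]; rewrite mulrAC ler_pdivlMr; lra.
have : C * (u / (n%:R - 1)) <= C * (8 / u) by rewrite ler_wpM2l //; lra.
rewrite !mulrA in mb *; lra.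
Qed.

(** * Cuts *)

(** Take the component of a node that fails to reach some other node, or its complement if the
    component exceeds half the nodes. Each [V k] spans a clique, so it lies on one side. *)
Lemma disconnected_cut (n m : nat) (V : {ffun 'I_m -> {set 'I_n}}) :
  ~~ rig_connected V ->
  exists S : {set 'I_n}, [&& (0 < #|S|)%N, (#|S|.*2 <= n)%N &
    [forall k, (V k \subset S) || (V k \subset ~: S)%SET]].
Proof.
move=> /forallPn[i /forallPn[j ij]].
pose S := [set v | connect (rig_adj V) i v]%SET.
have cut : [forall k, (V k \subset S) || (V k \subset ~: S)%SET].
  apply/forallP => k; case: (boolP (V k \subset S)) => //= /subsetPn[v vk vS].
  apply/fintype.subsetP => u uk; rewrite inE; apply: contra vS => uS.
  rewrite inE in uS; rewrite inE; apply: connect_trans uS _.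
  have [->//|uv] := eqVneq u v; apply: connect1; rewrite /rig_adj uv /=.
  by apply/existsP; exists k; rewrite uk vk.
have iS : (0 < #|S|)%N by apply/card_gt0P; exists i; rewrite inE connect0.
have jS : (0 < #|~: S|%SET)%N by apply/card_gt0P; exists j; rewrite !inE.
have := cardsC S; rewrite card_ord => cS.
have [le|gt] := leqP (#|S|.*2) n; first by exists S; apply/and3P.
exists (~: S)%SET; apply/and3P; split => //.
  by move: cS gt; rewrite -!addnn; move: #|S| #|~: S|%SET => a b; lia.
by apply/forallP => k; rewrite finset.setCK orbC; exact: (forallP cut).
Qed.

(** A Bonferroni inequality with [k^2 / 2] for the binomial coefficient; the induction step closes
    with slack [x^2 / 2 + k^2 x^3 / 2]. *)
Lemma expr_1Bx_le {R : realType} (x : R) k : 0 <= x <= 1 ->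
  (1 - x) ^+ k <= 1 - k%:R * x + k%:R ^+ 2 * x ^+ 2 / 2.
Proof.
move=> /andP[x0 x1]; elim: k => [|k IH]; first by rewrite expr0; lra.
rewrite exprS; apply: (le_trans (ler_wpM2l _ IH)); first by rewrite subr_ge0.
rewrite -[k.+1%:R]natr1; set K : R := k%:R.
have : 0 <= K ^+ 2 * x ^+ 3 by rewrite mulr_ge0 ?exprn_ge0.
have : 0 <= x ^+ 2 by rewrite exprn_ge0.
by move=> h1 h2; rewrite -subr_ge0; lra.
Qed.

Section Cut.
Context {R : realType} {n : nat} {f : nat -> R} (hf : is_pmf_on n f).

(** By [bin_ratio_le], a uniform [x]-set falls inside [S] with probability at most [s ^ x], and
    inside the complement with probability at most [(1 - s) ^ x]. *)
Lemma sum_set_prob_cut (S : {set 'I_n}) (s : R) : s = #|S|%:R / n%:R ->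
  \sum_(A : {set 'I_n} | (A \subset S) || (A \subset ~: S)%SET) set_prob f A <=
  1 - \sum_(2 <= x < n.+1) (1 - (s ^+ x + (1 - s) ^+ x)) * f x.
Proof.
move=> es; rewrite (sum_set_prob hf); last first.
  move=> A /card_le1_eqP A1; case: (boolP (A \subset S)) => //= /subsetPn[v vA vS].
  by apply/fintype.subsetP => u uA; rewrite (A1 _ _ vA uA) inE.
rewrite lerD2l lerN2; apply: ler_sum_nat => x /andP[x2]; rewrite ltnS => xn.
apply: ler_wpM2r; first exact: hf.1.
rewrite lerD2l lerN2.
have n0 : n%:R != 0 :> R by rewrite pnatr_eq0; lia.
have cS : (#|S| <= n)%N by rewrite -[leqRHS]card_ord max_card.
have cC : (#|~: S|%SET = n - #|S|)%N by rewrite cardsCs finset.setCK card_ord.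
have -> : 1 - s = (n - #|S|)%:R / n%:R by rewrite natrB // mulrBl divff // es.
rewrite es; apply: (le_trans _ (lerD (bin_ratio_le cS xn) (bin_ratio_le (leq_subr _ _) xn))).
rewrite -mulrDl ler_wpM2r ?invr_ge0 // -natrD ler_nat.
rewrite -cC -!cards_draws.
apply: leq_trans (leq_card_setU _ _); apply: subset_leq_card.
by apply/fintype.subsetP => A; rewrite !inE => /andP[/orP[]->->]; rewrite ?orbT.
Qed.

(** Sharp to first order in [s]: [expr_1Bx_le] bounds [(1 - s) ^ x], and
    [s ^ x <= s^2 <= x^2 s^2 / 2] for [x >= 2]. *)
Lemma sum_set_prob_cut_small (S : {set 'I_n}) : (0 < n)%N ->
  \sum_(A : {set 'I_n} | (A \subset S) || (A \subset ~: S)%SET) set_prob f A <=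
  1 - (#|S|%:R / n%:R * fmom n f 1 - (#|S|%:R / n%:R) ^+ 2 * fmom n f 2).
Proof.
move=> n0; apply: le_trans (sum_set_prob_cut (erefl (#|S|%:R / n%:R))) _.
set s := _ / _; have s01 : 0 <= s <= 1.
  rewrite divr_ge0 //= ler_pdivrMr ?ltr0n // mul1r ler_nat.
  by rewrite -[leqRHS]card_ord max_card.
rewrite lerD2l lerN2 /fmom !mulr_sumr -sumrB; apply: ler_sum_nat => x /andP[x2 xn].
rewrite !mulrA -mulrBl; apply: ler_wpM2r; first exact: hf.1.
have h1 := expr_1Bx_le x s01.
have h2 : s ^+ x <= s ^+ 2 by case/andP: s01 => s0 s1; rewrite ler_wiXn2l.
have h3 : 2 * s ^+ 2 <= x%:R ^+ 2 * s ^+ 2.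
  rewrite ler_wpM2r ?sqr_ge0 // -natrX ler_nat; nia.
by rewrite expr1; lra.
Qed.

(** For [x >= 2] and [s <= 1/2], [s ^ x + (1 - s) ^ x <= 1 - 2 s (1 - s) <= 1 - s]. *)
Lemma sum_set_prob_cut_large (S : {set 'I_n}) : (0 < n)%N -> (#|S|.*2 <= n)%N ->
  \sum_(A : {set 'I_n} | (A \subset S) || (A \subset ~: S)%SET) set_prob f A <=
  1 - #|S|%:R / n%:R * fmom n f 0.
Proof.
move=> n0 Sn; apply: le_trans (sum_set_prob_cut (erefl (#|S|%:R / n%:R))) _.
set s := _ / _; have s0 : 0 <= s by rewrite divr_ge0.
have s2 : s <= 2^-1.
  by rewrite ler_pdivrMr ?ltr0n // ler_pdivlMl // -natrM ler_nat mul2n.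
rewrite lerD2l lerN2 /fmom !mulr_sumr; apply: ler_sum_nat => x /andP[x2 xn].
rewrite expr0 mul1r; apply: ler_wpM2r; first exact: hf.1.
have h2 : s ^+ x <= s ^+ 2 by rewrite ler_wiXn2l //; lra.
have h1 : (1 - s) ^+ x <= (1 - s) ^+ 2 by rewrite ler_wiXn2l //; lra.
by nra.
Qed.

(** The branch [1 - C s] uses [(f)_2 <= C (f)_0 <= C (f)_1] in the small-cut bound; the branch
    [1 / C] uses [(f)_1 <= (f)_2 <= C (f)_0] in the large-cut bound. *)
Lemma sum_set_prob_cut_le (S : {set 'I_n}) (C : R) :
  (0 < n)%N -> (#|S|.*2 <= n)%N -> 0 < C -> fmom n f 2 <= C * fmom n f 0 ->
  \sum_(A : {set 'I_n} | (A \subset S) || (A \subset ~: S)%SET) set_prob f A <=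
  1 - #|S|%:R / n%:R * fmom n f 1 * Num.max (1 - C * (#|S|%:R / n%:R)) C^-1.
Proof.
move=> n0 Sn C0 hC; have f1 := fmom_ge0 hf 1.
have f01 := ler_fmom hf (leq0n 1); have f12 := ler_fmom hf (leqnSn 1).
have s0 : 0 <= #|S|%:R / n%:R :> R by rewrite divr_ge0.
case: (leP C^-1) => _.
  apply: le_trans (sum_set_prob_cut_small S n0) _; move: s0; set s := _ / _ => s0.
  rewrite lerD2l lerN2.
  have h : s ^+ 2 * fmom n f 2 <= s ^+ 2 * (C * fmom n f 1).
    by rewrite ler_wpM2l ?sqr_ge0 //; apply: le_trans hC _; rewrite ler_pM2l.
  by lra.
apply: le_trans (sum_set_prob_cut_large n0 Sn) _; rewrite lerD2l lerN2 -mulrA.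
rewrite ler_wpM2l // ler_pdivrMr // mulrC; exact: le_trans hC.
Qed.

End Cut.

(** * Union bound over cuts *)

(** This is [(e n / s) ^ s]: the series of [e ^ s] contains the term [s ^ s / s!], and
    ['C(n, s) s! <= n ^ s]. *)
Lemma bin_le_expR {R : realType} (n s : nat) : (0 < s)%N -> (s <= n)%N ->
  'C(n, s)%:R <= expR (s%:R * (ln n%:R + 1 - ln s%:R)) :> R.
Proof.
move=> s0 sn; have n0 := leq_trans s0 sn.
rewrite expRM_natl expRB expRD !lnK ?posrE ?ltr0n // expr_div_n exprMn -expRM_natl mulr1.
rewrite ler_pdivlMr ?exprn_gt0 ?ltr0n //.
have h : s%:R ^+ s <= expR s%:R * s`!%:R :> R.
  rewrite -ler_pdivrMr ?ltr0n ?fact_gt0 //.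
  case: s s0 {sn} => // s _; apply: le_trans (expR_ge1Dxn s _) => //.
  by rewrite lerDr.
apply: le_trans (ler_wpM2l _ h) _; first exact: ler0n.
rewrite mulrCA -natrM bin_ffact mulrC ler_wpM2r ?expR_ge0 // -natrX ler_nat.
rewrite ffact_prod -[X in (_ <= _ ^ X)%N]card_ord -prod_nat_const.
by apply: leq_prod => i _; exact: leq_subr.
Qed.

Lemma cut_term_le {R : realType} (n s : nat) (L C : R) :
  (0 < s)%N -> (s <= n)%N -> 1 <= C -> ln n%:R <= L ->
  'C(n, s)%:R * expR (- (s%:R * L * Num.max (1 - C * (s%:R / n%:R)) C^-1)) <=
  expR (1 + C ^+ 2 + (ln n%:R - L) / C) ^+ s.
Proof.
move=> s0 sn C1 uL; have n0 := leq_trans s0 sn.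
apply: le_trans (ler_wpM2r (expR_ge0 _) (bin_le_expR s0 sn)) _.
rewrite -expRD -expRM_natl ler_expR -mulrA -mulrBr ler_wpM2l ?ler0n //.
set g := Num.max _ _.
have gC : C^-1 <= g by rewrite le_max lexx orbT.
have gs : 1 - C * (s%:R / n%:R) <= g by rewrite le_max lexx.
set u := ln n%:R in uL *; set l := ln s%:R.
have u0 : 0 <= u by rewrite ln_ge0 // ler1n.
have l0 : 0 <= l by rewrite ln_ge0 // ler1n.
have C0 : 0 < C by lra.
(* Split [u - L g = u (1 - g) - (L - u) g]; in the second term [g >= 1 / C] and [L >= u]. *)
suff key : u * (1 - g) <= l + C ^+ 2.
  have : (L - u) * C^-1 <= (L - u) * g by rewrite ler_wpM2l // subr_ge0.
  by move: C^-1 => D; lra.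
(* For [s >= n ^ (1 - 1/C)] the branch [1/C] of [g] suffices; below that, [s / n]
   is at most [n ^ (- 1/C)], which beats the factor [ln n]. *)
have [h|h] := leP (u * (1 - C^-1)) l.
  have : u * (1 - g) <= u * (1 - C^-1) by rewrite ler_wpM2l // lerD2l lerN2.
  have := sqr_ge0 C; lra.
have : u * (1 - g) <= u * (C * (s%:R / n%:R)) by rewrite ler_wpM2l //; lra.
move=> /le_trans; apply; rewrite -[leLHS]add0r; apply: lerD => //.
have -> : s%:R / n%:R = expR (l - u) :> R by rewrite expRB !lnK ?posrE ?ltr0n.
have e1 : expR (l - u) <= expR (- (u / C)) by rewrite ler_expR; lra.
(* [y exp (- y) <= 1] at [y = u / C]; this is where the constant [C ^ 2] arises. *)
have e2 : u / C * expR (- (u / C)) <= 1.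
  rewrite expRN ler_pdivrMr ?expR_gt0 // mul1r.
  by apply: le_trans (expR_ge1Dx _); rewrite lerDr.
apply: (@le_trans _ _ (C ^+ 2 * (u / C * expR (- (u / C))))); last first.
  by rewrite -[leRHS]mulr1 ler_wpM2l ?sqr_ge0.
rewrite (_ : C ^+ 2 * _ = u * (C * expR (- (u / C)))); last first.
  by move: (expR _) => e; field; rewrite gt_eqF.
by rewrite ler_wpM2l // ler_wpM2l // ltW.
Qed.

Lemma geometric_sum_le2 {R : realType} (r : R) k : 0 <= r <= 2^-1 ->
  \sum_(i < k) r ^+ i <= 2.
Proof.
move=> /andP[r0 r2]; elim: k => [|k IH]; first by rewrite big_ord0.
rewrite big_ord_recl expr0 (eq_bigr (fun i : 'I_k => r * r ^+ i)); last first.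
  by move=> i _; rewrite -exprS.
by rewrite -mulr_sumr; nra.
Qed.

(** Each [S] of size [s] is uncrossed with probability at most [r ^ s / 'C(n, s)], so all sets of
    that size contribute at most [r ^ s]. Summed over [s >= 1] with [r <= 1/2], this is at most
    [2 r]. *)
Lemma prob_connected_ge {R : realType} (n m : nat) (f : nat -> R) (C : R) :
  let r := expR (1 + C ^+ 2 + (ln n%:R - m%:R / n%:R * fmom n f 1) / C) in
  is_pmf_on n f -> (0 < n)%N -> 1 <= C -> fmom n f 2 <= C * fmom n f 0 ->
  ln n%:R <= m%:R / n%:R * fmom n f 1 -> r <= 2^-1 ->
  1 - 2 * r <= prob_connected n m f.
Proof.
move=> r hf n0 C1 hC uL r2.
have C0 : 0 < C by lra.
pose cut (S : {set 'I_n}) (V : {ffun 'I_m -> {set 'I_n}}) : R :=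
  [forall k, (V k \subset S) || (V k \subset ~: S)%SET]%:R.
pose P (S : {set 'I_n}) := (0 < #|S|)%N && (#|S|.*2 <= n)%N.
have union : 1 <= prob_connected n m f + expect f (fun V => \sum_(S | P S) cut S V).
  rewrite -(expect_cst (m := m) hf 1) -expectD; apply: ler_expect => // V.
  have cut0 : 0 <= \sum_(S | P S) cut S V by apply: sumr_ge0.
  case: (boolP (rig_connected V)) => [_|/disconnected_cut[S /and3P[S0 S2 cS]]].
    by rewrite lerDl.
  rewrite add0r (bigD1 S) /=; last by rewrite /P S0.
  by rewrite /cut cS lerDl sumr_ge0.
suff : expect f (fun V => \sum_(S | P S) cut S V) <= 2 * r by lra.
rewrite expect_sum.
have hS (S : {set 'I_n}) : P S -> expect f (cut S) <= r ^+ #|S| / 'C(n, #|S|)%:R.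
  move=> /andP[S0 S2].
  have Sn : (#|S| <= n)%N by lia.
  rewrite ler_pdivlMr ?ltr0n ?bin_gt0 // mulrC.
  apply: le_trans (cut_term_le S0 Sn C1 uL); rewrite ler_wpM2l ?ler0n //.
  rewrite (expect_forall (fun A => (A \subset S) || (A \subset ~: S)%SET)).
  have := sum_set_prob_cut_le hf n0 S2 C0 hC.
  (* Raising [1 - y <= exp (- y)] to the power [m] gives the exponential of [cut_term_le]. *)
  set y := (X in 1 - X); move=> hy.
  rewrite (_ : - _ = m%:R * - y); last by rewrite /y; ring.
  rewrite expRM_natl; apply: lerXn2r; rewrite ?nnegrE ?expR_ge0 //.
    by apply: sumr_ge0 => A _; exact: set_prob_ge0.
  exact: le_trans hy (expR_ge1Dx _).
apply: le_trans (ler_sum _ hS) _.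
have hA (S : {set 'I_n}) : (#|S| < n.+1)%N.
  by rewrite ltnS -[leqRHS]card_ord max_card.
rewrite (partition_big (fun S => Ordinal (hA S)) (fun s => (0 < s)%N)) /=; last first.
  by move=> S /andP[].
apply: (@le_trans _ _ (\sum_(s < n.+1 | (0 < s)%N) r ^+ s)).
  apply: ler_sum => s s0.
  rewrite (eq_bigr (fun=> r ^+ s / 'C(n, s)%:R)) => [|S /andP[_ /eqP <-]//].
  have C0' : 0 < 'C(n, s)%:R :> R by rewrite ltr0n bin_gt0 -ltnS.
  rewrite sumr_const -[leLHS]mulr_natr mulrAC ler_pdivrMr //.
  rewrite ler_wpM2l ?exprn_ge0 ?expR_ge0 // ler_nat.
  have := card_draws 'I_n s; rewrite card_ord => <-; apply: subset_leq_card.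
  by apply/fintype.subsetP => S; rewrite !inE => /andP[_ /eqP <-].
rewrite big_mkcond big_ord_recl /= add0r.
rewrite (eq_bigr (fun i : 'I_n => r * r ^+ i)); last by move=> i _; rewrite -exprS.
rewrite -mulr_sumr mulrC ler_wpM2r ?expR_ge0 //.
by apply: geometric_sum_le2; rewrite expR_ge0.
Qed.

(** * Passage to the limit *)

Theorem mainTheorem3 (R : realType) (m : nat -> nat) (f : nat -> nat -> R)
  (hm : forall n, (1 <= m n)%N)
  (hf : forall n, is_pmf_on n (f n))
  (hmom : exists C : R, \forall n \near \oo,
            fmom n (f n) 2 <= C * `|fmom n (f n) 0|) :
  let t := fun n : nat => ln (n%:R : R) - (m n)%:R / n%:R * fmom n (f n) 1 in
  ((t @ \oo --> +oo) -> (fun n => prob_connected n (m n) (f n)) @ \oo --> (0 : R)) /\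
  ((t @ \oo --> -oo) -> (fun n => prob_connected n (m n) (f n)) @ \oo --> (1 : R)).
Proof.
move=> t; case: hmom => C0 hC0.
(* [C0] may be small or negative, while the bounds for fixed [n] ask for [C >= 1]; enlarging it is
   harmless since [(f)_0 >= 0]. *)
pose C := Num.max C0 1.
have C1 : 1 <= C by rewrite le_max lexx orbT.
have Cpos : 0 < C by lra.
have hC : \forall n \near \oo, fmom n (f n) 2 <= C * fmom n (f n) 0.
  near=> n; have : fmom n (f n) 2 <= C0 * `|fmom n (f n) 0| by near: n.
  rewrite ger0_norm ?fmom_ge0 // => /le_trans; apply.
  by rewrite ler_wpM2r ?fmom_ge0 // le_max lexx.
split=> [/cvgryPge ht|/cvgrNyPle ht].
- apply/cvgr0Pnorm_le => e e0.
  have le0 : 0 < ln (1 + e / 2) by rewrite ln_gt0 // ltrDl divr_gt0.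
  near=> n.
  have n1 : (1 < n)%N by near: n; exact: nbhs_infty_ge.
  have N0 : 0 < n%:R :> R by rewrite ltr0n ltnW.
  have hCn : fmom n (f n) 2 <= C * fmom n (f n) 0 by near: n.
  have Cn : 2 * C <= n%:R by near: n; exact: nbhs_infty_ger.
  have t0 : 0 <= t n by near: n; exact: ht.
  have tL : (m n)%:R / n%:R * fmom n (f n) 1 <= ln n%:R by rewrite -subr_ge0.
  (* This threshold and the next make the two exponentials at most [e / 2] and [1 + e / 2]. *)
  have te : 2 * C - ln (e / 2) <= t n by near: n; exact: ht.
  have lnn : 32 * C / ln (1 + e / 2) <= ln n%:R.
    rewrite -[leLHS]expRK ler_ln ?posrE ?expR_gt0 //.
    by near: n; exact: nbhs_infty_ger.
  rewrite ger0_norm; last by rewrite -(expect_cst (m := m n) (hf n) 0);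
    apply: ler_expect => // V; rewrite ler0n.
  have := prob_connected_le_expR (hf n) n1 C1 Cn hCn tL.
  move=> /le_trans; apply.
  have h1 : expR (2 * C - t n) <= e / 2.
    by rewrite -[leRHS]lnK ?posrE ?divr_gt0 // ler_expR; lra.
  have h2 : expR (32 * C / ln n%:R) <= 1 + e / 2.
    rewrite -[leRHS]lnK ?posrE ?addr_gt0 ?divr_gt0 // ler_expR.
    rewrite ler_pdivrMr ?ln_gt0 ?ltr1n //.
    by move: lnn; rewrite ler_pdivrMr // [leRHS]mulrC.
  by rewrite -/(t n); lra.
- apply/cvgrPdist_le => e e0.
  (* With [r <= d], the bound [1/2] admits the geometric sum and [e / 2] gives [2 r <= e]. *)
  pose d := Num.min (2^-1) (e / 2).
  have d0 : 0 < d by rewrite lt_min divr_gt0 ?andbT.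
  near=> n.
  have n0 : (0 < n)%N by near: n; exact: nbhs_infty_ge.
  have hCn : fmom n (f n) 2 <= C * fmom n (f n) 0 by near: n.
  have t0 : t n <= 0 by near: n; exact: ht.
  have tL : ln n%:R <= (m n)%:R / n%:R * fmom n (f n) 1 by rewrite -subr_le0.
  have te : t n <= C * (ln d - (1 + C ^+ 2)) by near: n; exact: ht.
  have r_le : expR (1 + C ^+ 2 + t n / C) <= d.
    rewrite -[leRHS]lnK ?posrE // ler_expR.
    by move: te; rewrite mulrC -ler_pdivrMr //; lra.
  have r2 := r_le; rewrite le_min in r2; case/andP: r2 => r2 re.
  have := prob_connected_ge (hf n) n0 C1 hCn tL r2; rewrite -/(t n) => h.
  have P1 : prob_connected n (m n) (f n) <= 1.
    rewrite -(expect_cst (m := m n) (hf n) 1).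
    by apply: ler_expect => // V; rewrite lern1 leq_b1.
  by rewrite ger0_norm ?subr_ge0 //; lra.
Unshelve. all: by end_near.
Qed.
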